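(* Let $C$ be a continuous FOS process on $G$ and let $R=R(C)$ be the discrete FOS process obtained from $C$ by the randomized rounding transformation, started from the same integral initial load vector. Then for every round $t$ and every node $k$, with high probability $$\left|X^{R}_k(t)-x^{C}_k(t)\right| = O\left(\Upsilon^{C}(G)\cdot\sqrt{d\log n}\right).$$
   Context: $G=(V,E)$ is a finite undirected graph with $V=\{1,\dots,n\}$, $n\ge 2$, maximum degree $d$; $N(i)$ is the set of neighbors of $i$. Node $i$ has speed $s_i\ge 1$. For each edge there is a parameter $\alpha_{i,j}=\alpha_{j,i}>0$ with $\sum_{j\in N(i)}\alpha_{i,j}\le 1$. Continuous FOS: $y_{i,j}(t)=C(x(t))_{i,j}=\alpha_{i,j}(x_i(t)/s_i-x_j(t)/s_j)$ is the load sent from $i$ to $j\in N(i)$ in round $t$ and $x_i(t+1)=x_i(t)-\sum_{j\in N(i)}y_{i,j}(t)$. Randomized rounding transformation $R(C)$: in round $t$, with current load vector $X^R(t)$, let $\hat Y(t)=C(X^R(t))$. Write $\{a\}=a-\lfloor a\rfloor$. Each node $i$ first rounds down $\hat Y_{i,j}(t)$ for all $j\in N(i)$ with $\hat Y_{i,j}(t)\ge 0$. Let $r=\sum_{j:\hat Y_{i,j}(t)\ge0}\{\hat Y_{i,j}(t)\}$. Node $i$ takes $\lceil r\rceil$ excess tokens; independently, each of them is sent out with probability $r/\lceil r\rceil$ (otherwise it stays on $i$), and a token that is sent out goes to neighbor $j$ (with $\hat Y_{i,j}(t)\ge 0$) with probability $\{\hat Y_{i,j}(t)\}/r$. With $Z_{i,j}(t)$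 the number of excess tokens $i$ sends to $j$, the discrete flow is $Y^R_{i,j}(t)=\lfloor\hat Y_{i,j}(t)\rfloor+Z_{i,j}(t)$ if $\hat Y_{i,j}(t)\ge0$ and $Y^R_{i,j}(t)=-Y^R_{j,i}(t)$ otherwise; $X^R_i(t+1)=X^R_i(t)-\sum_{j\in N(i)}Y^R_{i,j}(t)$. The random choices of different nodes and rounds are independent given the current loads. Contribution: $\mathcal{C}^C_{k,i\rightarrow j}(t)=\mathbf{x}_k-\mathbf{x}'_k$, where $\mathbf{x},\mathbf{x}'$ are the load vectors obtained by applying $C$ for $t$ rounds starting from the unit vectors $\hat{\mathbf i}$, $\hat{\mathbf j}$. Refined local divergence: $$\Upsilon^{C}(G)=\max_{k\in V}\Big(\sum_{s=0}^{\infty}\sum_{i=1}^n\max_{j\in N(i)}\big(\mathcal{C}^C_{k,i\rightarrow j}(s)\big)^2\Big)^{1/2}.$$ ''With high probability'' means with probability at least $1-n^{-a}$ for some constant $a>0$; the constant hidden in $O(\cdot)$ is absolute. *)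

(* Defs.v *)
(* MathComp + MathComp-Analysis. *)
From HB Require Import structures.
From mathcomp Require Import all_boot all_order all_algebra.
From mathcomp Require Import all_classical all_reals all_analysis.

Set Implicit Arguments.
Unset Strict Implicit.
Unset Printing Implicit Defensive.

Import Order.TTheory GRing.Theory Num.Theory.

Local Open Scope classical_set_scope.
Local Open Scope ring_scope.

(* A first order diffusion scheme together with the network on which it runs.
   The values of [alpha] outside the edges are irrelevant. *)
Record fos (R : realType) (n : nat) := Fos {
  adj : rel 'I_n;
  adj_sym : symmetric adj;
  adj_irr : irreflexive adj;
  speed : 'I_n -> R;
  speed_ge1 : forall i, 1 <= speed i;
  alpha : 'I_n -> 'I_n -> R;
  alpha_sym : forall i j, adj i j -> alpha i j = alpha j i;
  alpha_gt0 : forall i j, adj i j -> 0 < alpha i j;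
  alpha_sum : forall i, \sum_(j | adj i j) alpha i j <= 1
}.

Definition max_degree (R : realType) (n : nat) (C : fos R n) : nat :=
  (\max_(i < n) #|[set j | adj C i j]%SET|)%N.

Definition fos_flow (R : realType) (n : nat) (C : fos R n) (x : 'rV[R]_n)
    (i j : 'I_n) : R :=
  alpha C i j * (x 0 i / speed C i - x 0 j / speed C j).

Definition fos_step (R : realType) (n : nat) (C : fos R n) (x : 'rV[R]_n)
    : 'rV[R]_n :=
  \row_i (x 0 i - \sum_(j | adj C i j) fos_flow C x i j).

Definition fos_load (R : realType) (n : nat) (C : fos R n) (x0 : 'rV[R]_n)
    (t : nat) : 'rV[R]_n :=
  iter t (fos_step C) x0.

(* [contribution C k i j t] is the contribution of the edge i -> j to node k
   after t rounds. *)
Definition contribution (R : realType) (n : nat) (C : fos R n)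
    (k i j : 'I_n) (t : nat) : R :=
  fos_load C (delta_mx 0 i) t 0 k - fos_load C (delta_mx 0 j) t 0 k.

(* The series may diverge (for instance if the diffusion matrix has the
   eigenvalue -1), hence the extended real value. The inner maximum ranges over
   nonnegative reals, so its default value 0 only matters for isolated i. *)
Definition refined_local_divergence (R : realType) (n : nat) (C : fos R n)
    : \bar R :=
  (\big[maxe/-oo]_(k < n)
    sqrte (\sum_(0 <= s <oo)
      (\sum_(i < n)
         \big[Num.max/0%R]_(j | adj C i j) (contribution C k i j s ^+ 2))%R%:E))%E.

Definition frac (R : realType) (a : R) : R := a - (Num.floor a)%:~R.

(* The continuous flow prescribed by C on an integral load vector. *)
Definition scheduled_flow (R : realType) (n : nat) (C : fos R n)
    (x : 'rV[int]_n) : 'I_n -> 'I_n -> R :=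
  fos_flow C (map_mx intr x).

Definition excess (R : realType) (n : nat) (C : fos R n) (x : 'rV[int]_n)
    (i : 'I_n) : R :=
  \sum_(j | adj C i j && (0 <= scheduled_flow C x i j))
     frac (scheduled_flow C x i j).

Definition num_tokens (R : realType) (n : nat) (C : fos R n) (x : 'rV[int]_n)
    (i : 'I_n) : nat :=
  `|Num.ceil (excess C x i)|%N.

(* Distribution of the destination of one excess token of node i: [Some j] if
   it is sent to j, [None] if it stays on i. Only meaningful when node i has an
   excess token. *)
Definition token_law (R : realType) (n : nat) (C : fos R n) (x : 'rV[int]_n)
    (i : 'I_n) (c : option 'I_n) : R :=
  let r := excess C x i in
  let p := r / (num_tokens C x i)%:R in
  if c is Some j then
    if adj C i j && (0 <= scheduled_flow C x i j)
    then p * (frac (scheduled_flow C x i j) / r) else 0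
  else 1 - p.

(* [c i m] is the destination of the m-th excess token of node i in one round;
   it is ignored unless m < num_tokens C x i. *)
Definition choices (n : nat) := 'I_n -> nat -> option 'I_n.

Definition tokens_sent (R : realType) (n : nat) (C : fos R n)
    (x : 'rV[int]_n) (c : choices n) (i j : 'I_n) : nat :=
  (\sum_(m < num_tokens C x i) (c i m == Some j))%N.

Definition rounded_flow (R : realType) (n : nat) (C : fos R n)
    (x : 'rV[int]_n) (c : choices n) (i j : 'I_n) : int :=
  let down u v :=
    Num.floor (scheduled_flow C x u v) + (tokens_sent C x c u v)%:Z in
  if 0 <= scheduled_flow C x i j then down i j else - down j i.

Definition rounded_step (R : realType) (n : nat) (C : fos R n)
    (x : 'rV[int]_n) (c : choices n) : 'rV[int]_n :=
  \row_i (x 0 i - \sum_(j | adj C i j) rounded_flow C x c i j).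

(* Load vector of R(C) after t rounds, when the choices made in round s are
   [h s]. *)
Fixpoint rounded_load (R : realType) (n : nat) (C : fos R n)
    (x0 : 'rV[int]_n) (h : nat -> choices n) (t : nat) : 'rV[int]_n :=
  if t is s.+1 then rounded_step C (rounded_load C x0 h s) (h s) else x0.

(* The event that in the rounds before t every excess token takes the
   destination given by the history h. *)
Definition follows (R : realType) (n : nat) (C : fos R n) (x0 : 'rV[int]_n)
    (T : Type) (D : nat -> 'I_n -> nat -> T -> option 'I_n)
    (h : nat -> choices n) (t : nat) : set T :=
  [set w | forall (s : nat) (i : 'I_n) (m : nat), (s < t)%N ->
     (m < num_tokens C (rounded_load C x0 h s) i)%N -> D s i m w = h s i m].

(* D s i m is the random destination of the m-th excess token of node i in
   round s. Given the choices of the earlier rounds, hence the current load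
   vector, the excess tokens of all the nodes are independent with distribution
   [token_law]; the conditional probability is written as a product, so that
   histories of probability 0 need no special treatment. *)
Definition randomized_rounding (R : realType) (n : nat) (C : fos R n)
    (x0 : 'rV[int]_n) (d : measure_display) (T : measurableType d)
    (P : probability T R) (D : nat -> 'I_n -> nat -> T -> option 'I_n)
    : Prop :=
  (forall s i m c, measurable [set w | D s i m w = c]) /\
  (forall (h : nat -> choices n) (t : nat),
     let x := rounded_load C x0 h t in
     P (follows C x0 D h t.+1) =
     (P (follows C x0 D h t) *
      (\prod_(i < n) \prod_(m < num_tokens C x i)
         token_law C x i (h t i m))%R%:E)%E).

(* Main.v *)
(* Write e_i for the i-th unit vector and L_r(x) for the load of node k after r
   rounds of the linear continuous process started from x. In one rounded round
   from x, the value L_r(next load) differs from L_{r+1}(x) by a sum over the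
   excess tokens of independent centred terms; a token that leaves i for j
   contributes L_r(e_i) - L_r(e_j), so the terms of node i are at most twice
   max_j |L_r(e_i) - L_r(e_j)|, and node i has at most d tokens. Hence
   exp(lam (L_{t-s}(X_s) - L_t(x_0)) + 8 lam^2 d V_s), where V_s is the part of
   the squared refined local divergence still to be paid, is a supermartingale
   of the Markov chain X_s. Optimising lam in the resulting Chernoff bound gives
   an error probability of at most 2 n^(-2). *)
Require Import Defs.
From HB Require Import structures.
From mathcomp Require Import all_boot all_order all_algebra.
From mathcomp Require Import all_classical all_reals all_analysis.
From mathcomp Require Import ring lra.

Set Implicit Arguments.
Unset Strict Implicit.
Unset Printing Implicit Defensive.

Import Order.TTheory GRing.Theory Num.Theory.

Local Open Scope classical_set_scope.
Local Open Scope ring_scope.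

(** * Exponential moments of bounded centred variables *)

(** For [x > 1] already [x <= 2 * x ^+ 2]. For [x <= 1], squaring [1 - x / 2 <= expR (- (x / 2))]
    bounds [expR (- x)] below by a polynomial whose product with [1 + x + 2 * x ^+ 2] is at least
    1. *)
Lemma expR_le_add_expR_sqr (R : realType) (x : R) :
  expR x <= x + expR (2 * x ^+ 2).
Proof.
have [x1|x1] := leP x 1; last first.
  have : expR x <= expR (2 * x ^+ 2) by rewrite ler_expR; nra.
  lra.
have h1 : 1 - x / 2 <= expR (- (x / 2)) := expR_ge1Dx _.
have h2 : 1 + 2 * x ^+ 2 <= expR (2 * x ^+ 2) := expR_ge1Dx _.
have h3 : (1 - x / 2) ^+ 2 <= expR (- x).
  have -> : - x = - (x / 2) + - (x / 2) by field.
  by rewrite expRD -expr2 ler_pXn2r// nnegrE ?expR_ge0//; lra.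
suff : expR x <= 1 + x + 2 * x ^+ 2 by lra.
have h4 : 1 <= (1 + x + 2 * x ^+ 2) * (1 - x / 2) ^+ 2.
  rewrite -subr_ge0; have -> : (1 + x + 2 * x ^+ 2) * (1 - x / 2) ^+ 2 - 1 =
    x ^+ 2 * ((5 - 2 * x) * (1 - x)) / 4 by field.
  apply: divr_ge0; last by [].
  by apply: mulr_ge0; [exact: sqr_ge0 | apply: mulr_ge0; lra].
have h5 : 0 <= 1 + x + 2 * x ^+ 2 by nra.
have h6 : 1 <= (1 + x + 2 * x ^+ 2) * expR (- x).
  by apply: (le_trans h4); rewrite ler_wpM2l.
by rewrite -[leLHS]mul1r -ler_pdivlMr ?expR_gt0// -expRN.
Qed.

(* Hoeffding's lemma with a worse constant; expR x <= x + expR (2 x ^+ 2) makes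
   the first-order terms cancel. *)
Lemma mgf_le (R : realType) (I : finType) (q z : I -> R) (b lam : R) :
  (forall i, 0 <= q i) -> \sum_i q i = 1 -> \sum_i q i * z i = 0 ->
  (forall i, q i != 0 -> `|z i| <= b) ->
  \sum_i q i * expR (lam * z i) <= expR (2 * (lam ^+ 2 * b ^+ 2)).
Proof.
move=> q0 q1 qz zb.
have -> : expR (2 * (lam ^+ 2 * b ^+ 2)) =
    lam * (\sum_i q i * z i) + (\sum_i q i) * expR (2 * (lam ^+ 2 * b ^+ 2)).
  by rewrite qz q1 mulr0 add0r mul1r.
rewrite mulr_sumr mulr_suml -big_split/=; apply: ler_sum => i _.
have [->|qi] := eqVneq (q i) 0; first by rewrite !mul0r mulr0 addr0.
rewrite [lam * (_ * _)]mulrCA -mulrDr; apply: ler_wpM2l => //.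
apply: (le_trans (expR_le_add_expR_sqr _)); rewrite lerD2l ler_expR.
rewrite exprMn ler_wpM2l// ler_wpM2l ?sqr_ge0//.
by rewrite -(real_normK (num_real (z i)))
  ler_pXn2r ?nnegrE ?zb// (le_trans (normr_ge0 _) (zb _ qi)).
Qed.

(** * Fractional parts, excess tokens and the law of one token *)

Lemma frac_ge0 (R : realType) (a : R) : 0 <= Defs.frac a.
Proof. by rewrite subr_ge0 floor_le. Qed.

Lemma frac_lt1 (R : realType) (a : R) : Defs.frac a < 1.
Proof. by have := floorD1_gt a; rewrite intrD /Defs.frac; lra. Qed.

Lemma frac0 (R : realType) : Defs.frac (0 : R) = 0.
Proof. by rewrite /Defs.frac floor0 subr0. Qed.

Lemma excess_ge0 (R : realType) (n : nat) (C : fos R n) (x : 'rV[int]_n) i :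
  0 <= excess C x i.
Proof. by apply: sumr_ge0 => j _; exact: frac_ge0. Qed.

Lemma num_tokensE (R : realType) (n : nat) (C : fos R n) (x : 'rV[int]_n) i :
  (num_tokens C x i)%:Z = Num.ceil (excess C x i).
Proof.
rewrite /num_tokens gez0_abs// ceil_ge0.
by rewrite (lt_le_trans _ (excess_ge0 _ _ _))// ltrN10.
Qed.

Lemma excess_le (R : realType) (n : nat) (C : fos R n) (x : 'rV[int]_n) i :
  excess C x i <= (num_tokens C x i)%:R.
Proof. by rewrite pmulrn num_tokensE; exact: ceil_ge. Qed.

(** Each summand of the excess is below 1, so the excess, and with it its ceiling, is at most the
    degree. This is the source of the factor d. *)
Lemma num_tokens_le_degree (R : realType) (n : nat) (C : fos R n)
    (x : 'rV[int]_n) i :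
  (num_tokens C x i <= #|[set j | adj C i j]%SET|)%N.
Proof.
rewrite -lez_nat num_tokensE ceil_le_int -pmulrn.
rewrite /excess cardsE -sum1_card natr_sum big_mkcondr/=; apply: ler_sum => j _.
by case: ifP => // _; exact: ltW (frac_lt1 _).
Qed.

Lemma num_tokens_le (R : realType) (n : nat) (C : fos R n) (x : 'rV[int]_n) i :
  (num_tokens C x i <= n)%N.
Proof.
by apply: (leq_trans (num_tokens_le_degree _ _ _)); rewrite -[leqRHS]card_ord max_card.
Qed.

Lemma num_tokens_le_max_degree (R : realType) (n : nat) (C : fos R n)
    (x : 'rV[int]_n) i :
  (num_tokens C x i <= max_degree C)%N.
Proof.
exact: leq_trans (num_tokens_le_degree _ _ _) (leq_bigmax (F := fun i => _) i).
Qed.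

Lemma token_law_ge0 (R : realType) (n : nat) (C : fos R n) (x : 'rV[int]_n)
    i c :
  0 <= token_law C x i c.
Proof.
rewrite /token_law; case: c => [j|].
  by case: ifP => // _; rewrite !mulr_ge0 ?invr_ge0 ?excess_ge0 ?frac_ge0.
rewrite subr_ge0; have [->|n0] := eqVneq (num_tokens C x i) 0%N.
  by rewrite invr0 mulr0.
by rewrite ler_pdivrMr ?ltr0n ?lt0n// mul1r excess_le.
Qed.

Lemma big_option (R : nmodType) (I : finType) (F : option I -> R) :
  \sum_o F o = F None + \sum_i F (Some i).
Proof.
rewrite (bigD1 None)//=; congr (_ + _).
rewrite (reindex_omap Some id) => [|[i|]//]; apply: eq_bigl => i /=.
by rewrite eqxx.
Qed.

Lemma sum_token_law (R : realType) (n : nat) (C : fos R n) (x : 'rV[int]_n) i :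
  \sum_c token_law C x i c = 1.
Proof.
rewrite big_option /token_law -big_mkcond/= -mulr_sumr -mulr_suml -/(excess C x i).
(* With zero excess all quotients are 0 and [None] carries the whole mass. *)
have [->|e0] := eqVneq (excess C x i) 0; first by rewrite !(mul0r, subr0, addr0).
by rewrite divff// mulr1 subrK.
Qed.

(** * Linearity of the continuous process *)

Lemma fos_step_linear (R : realType) (n : nat) (C : fos R n) a (x y : 'rV[R]_n) :
  fos_step C (a *: x + y) = a *: fos_step C x + fos_step C y.
Proof.
apply/rowP => i; rewrite !mxE mulrBr mulr_sumr addrACA -opprD -big_split/=.
by congr (_ - _); apply: eq_bigr => j _; rewrite /fos_flow !mxE; ring.
Qed.

Lemma fos_load_linear (R : realType) (n : nat) (C : fos R n) a (x y : 'rV[R]_n) t :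
  fos_load C (a *: x + y) t = a *: fos_load C x t + fos_load C y t.
Proof. by elim: t => [//|t IH]; rewrite /fos_load !iterS -fos_step_linear -IH. Qed.

(** Linearity reduces any start vector to unit vectors; differences of the resulting coefficients
    are the contributions. *)
Lemma fos_load_decomp (R : realType) (n : nat) (C : fos R n) (x : 'rV[R]_n) t k :
  fos_load C x t 0 k = \sum_i x 0 i * fos_load C (delta_mx 0 i) t 0 k.
Proof.
have load0 : fos_load C 0 t = 0.
  by have := fos_load_linear C (-1) 0 0 t; rewrite !scaleN1r !addNr.
rewrite {1}(row_sum_delta x).
elim/big_ind2: _ => [|y u z v yu zv|i _]; first by rewrite load0 mxE.
  by rewrite -yu -zv -[X in fos_load C (X + _)]scale1r fos_load_linear scale1r mxE.
by rewrite -[_ *: _]addr0 fos_load_linear load0 addr0 mxE.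
Qed.

(** * Antisymmetry of the flow and the joint law of the choices of one round *)

Lemma scheduled_flowN (R : realType) (n : nat) (C : fos R n) (x : 'rV[int]_n) i j :
  adj C i j -> scheduled_flow C x j i = - scheduled_flow C x i j.
Proof.
by move=> /alpha_sym aij; rewrite /scheduled_flow /fos_flow aij; ring.
Qed.

(* Extends [token_law] to all pairs (i, m) with m < n: a slot that holds no
   excess token deterministically gets [None], so that the histories range over
   a fixed finite type. *)
Definition choice_law (R : realType) (n : nat) (C : fos R n) (x : 'rV[int]_n)
    (p : 'I_n * 'I_n) (c : option 'I_n) : R :=
  if (p.2 < num_tokens C x p.1)%N then token_law C x p.1 c else (c == None)%:R.

(** The product runs over a fixed grid of slots, so that sums over [c] factor slot by slot. *)
Definition round_prob (R : realType) (n : nat) (C : fos R n) (x : 'rV[int]_n)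
    (c : {ffun 'I_n * 'I_n -> option 'I_n}) : R :=
  \prod_p choice_law C x p (c p).

(** Indices from [n] on get [None], which is harmless since no node has more than [n] tokens. *)
Definition round_choices (n : nat) (c : {ffun 'I_n * 'I_n -> option 'I_n}) :
    choices n :=
  fun i m => if insub m is Some m' then c (i, m') else None.

Lemma round_choicesE (n : nat) (c : {ffun 'I_n * 'I_n -> option 'I_n})
  (i m : 'I_n) : round_choices c i m = c (i, m).
Proof. by rewrite /round_choices valK. Qed.

Lemma choice_law_ge0 (R : realType) (n : nat) (C : fos R n) (x : 'rV[int]_n) p c :
  0 <= choice_law C x p c.
Proof. by rewrite /choice_law; case: ifP => // _; exact: token_law_ge0. Qed.

Lemma round_prob_ge0 (R : realType) (n : nat) (C : fos R n) (x : 'rV[int]_n) c :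
  0 <= round_prob C x c.
Proof. by apply: prodr_ge0 => p _; exact: choice_law_ge0. Qed.

Lemma sum_choice_law (R : realType) (n : nat) (C : fos R n) (x : 'rV[int]_n) p :
  \sum_c choice_law C x p c = 1.
Proof.
rewrite /choice_law; case: (p.2 < _)%N; first exact: sum_token_law.
by rewrite big_option/= big1_eq addr0.
Qed.

Lemma sum_round_prob (R : realType) (n : nat) (C : fos R n) (x : 'rV[int]_n) :
  \sum_c round_prob C x c = 1.
Proof.
by rewrite -(bigA_distr_bigA (choice_law C x)) big1// => p _; exact: sum_choice_law.
Qed.

(** A zero flow has fractional part 0. Excluding it settles the edges without flow, where both
    endpoints pass the sign test for senders. *)
Lemma token_law_Some_neq0 (R : realType) (n : nat) (C : fos R n)
    (x : 'rV[int]_n) i j :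
  token_law C x i (Some j) != 0 ->
  [/\ adj C i j, 0 <= scheduled_flow C x i j & scheduled_flow C x i j != 0].
Proof.
rewrite /token_law; case: ifP => [/andP[aij fij]|]; last by rewrite eqxx.
by have [->|f0] := eqVneq (scheduled_flow C x i j) 0; rewrite ?frac0 ?mul0r ?mulr0 ?eqxx.
Qed.

Lemma big_num_tokens (R : realType) (n : nat) (C : fos R n) (x : 'rV[int]_n) i
    (S : Type) (idx : S) (op : Monoid.law idx) (F : nat -> S) :
  \big[op/idx]_(m < num_tokens C x i) F m =
  \big[op/idx]_(m < n | (m < num_tokens C x i)%N) F m.
Proof. exact: (big_ord_widen n F (num_tokens_le _ _ _)). Qed.

(** * Rounding error of one round, token by token *)

(** The load that node [k] loses, [r] rounds later, when the token leaves [i] instead of staying;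
    with this sign the deviation is mean minus gain. *)
Definition token_gain (R : realType) (n : nat) (C : fos R n) (k : 'I_n) (r : nat)
    (i : 'I_n) (c : option 'I_n) : R :=
  if c is Some j then contribution C k i j r else 0.

Definition mean_gain (R : realType) (n : nat) (C : fos R n) (x : 'rV[int]_n)
    (k : 'I_n) (r : nat) (i : 'I_n) : R :=
  \sum_c token_law C x i c * token_gain C k r i c.

(** The divisions by the number of tokens and by the excess cancel. These two numbers vanish
    together, and then so do all the fractional parts. *)
Lemma num_tokens_mean_gain (R : realType) (n : nat) (C : fos R n)
    (x : 'rV[int]_n) k r i :
  (num_tokens C x i)%:R * mean_gain C x k r i =
  \sum_(j | adj C i j && (0 <= scheduled_flow C x i j))
     Defs.frac (scheduled_flow C x i j) * contribution C k i j r.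
Proof.
rewrite /mean_gain big_option/= mulr0 add0r mulr_sumr [RHS]big_mkcond/=.
apply: eq_bigr => j _; case: ifP => vij; last by rewrite mul0r mulr0.
have [N0|N0] := eqVneq (num_tokens C x i) 0%N.
  rewrite N0 mul0r; suff -> : Defs.frac (scheduled_flow C x i j) = 0 by rewrite mul0r.
  have /eqP : excess C x i = 0.
    by apply/eqP; rewrite eq_le excess_ge0 andbT -[leRHS](_ : 0%:R = 0) // -N0 excess_le.
  rewrite /excess psumr_eq0 => [/allP/(_ j)|? _]; last exact: frac_ge0.
  by rewrite mem_index_enum vij/= => /(_ isT)/eqP.
have [r0|r0] := eqVneq (excess C x i) 0.
  have := num_tokensE C x i; rewrite r0 ceil0 => /eqP.
  by rewrite eqz_nat (negPf N0).
have N0' : (num_tokens C x i)%:R != 0 :> R by rewrite pnatr_eq0.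
by field; rewrite r0.
Qed.

(* The rounding errors of one round, propagated to node k by r further rounds
   of the continuous process, split into one centred term per excess token. *)
Lemma round_deviation (R : realType) (n : nat) (C : fos R n) (x : 'rV[int]_n)
    c k r :
  round_prob C x c != 0 ->
  fos_load C (map_mx intr (rounded_step C x (round_choices c))) r 0 k
  = fos_load C (map_mx intr x) r.+1 0 k
  + \sum_(p : 'I_n * 'I_n | (p.2 < num_tokens C x p.1)%N)
      (mean_gain C x k r p.1 - token_gain C k r p.1 (c p)).
Proof.
move=> c0.
have law0 (p : 'I_n * 'I_n) : (p.2 < num_tokens C x p.1)%N -> token_law C x p.1 (c p) != 0.
  move=> pN; apply: contra_neq c0 => e.
  by rewrite /round_prob (bigD1 p)//= /choice_law pN e mul0r.
rewrite [fos_load C _ r.+1]/fos_load iterSr -/(fos_load C _ r).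
rewrite 2![fos_load C _ r 0 k]fos_load_decomp.
set a := fun i => fos_load C (delta_mx 0 i) r 0 k.
apply/eqP; rewrite addrC -subr_eq -sumrB; apply/eqP.
pose f := scheduled_flow C x.
pose Z i j : R := (tokens_sent C x (round_choices c) i j)%:R.
(* [w i j] is the rounding error that [i] makes as a sender towards [j]. *)
pose v i j := adj C i j && (0 <= f i j).
pose w i j := if v i j then Defs.frac (f i j) - Z i j else 0.
have ZE i j : Z i j = \sum_(m < n | (m < num_tokens C x i)%N) (c (i, m) == Some j)%:R.
  rewrite /Z /tokens_sent natr_sum.
  rewrite (big_num_tokens C x i +%R (fun m => (round_choices c i m == Some j)%:R)).
  by apply: eq_bigr => m _; rewrite round_choicesE.
have Z0 i j : f i j = 0 -> Z i j = 0.
  move=> f0; rewrite ZE big1// => m mN; case: eqP => // cE.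
  by have := law0 (i, m) mN; rewrite cE => /token_law_Some_neq0[_ _]; rewrite -/(f i j) f0 eqxx.
have errE i j : adj C i j ->
    f i j - (rounded_flow C x (round_choices c) i j)%:~R = w i j - w j i.
  move=> aij; rewrite /rounded_flow -/(f i j) /w /v.
  have aji : adj C j i by rewrite adj_sym.
  have fN : f j i = - f i j by exact: scheduled_flowN.
  rewrite aij aji /=; case: (ltrgtP 0 (f i j)) => [fij|fij|fij].
  - rewrite fN oppr_ge0 leNgt fij/= subr0 intrD -/(f i j) /Defs.frac /Z -pmulrn.
    by rewrite opprD addrA.
  - rewrite fN oppr_ge0 (ltW fij) /= -/(f j i) fN sub0r intrN intrD /Defs.frac /Z -pmulrn.
    by ring.
  (* Both endpoints count as senders here, but neither sends a token. *)
  - have f0 : f i j = 0 by rewrite -fij.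
    have f0' : f j i = 0 by rewrite fN f0 oppr0.
    rewrite f0 f0' lexx (Z0 i j)// (Z0 j i)// frac0 floor0 add0r.
    by rewrite -pmulrn -/(Z i j) Z0// !subr0 oppr0.
(* Summation by parts: exchanging the indices in the [w j i] half collects the factor [a i - a j], a
   contribution, at each [w i j]. *)
transitivity (\sum_i \sum_j w i j * contribution C k i j r).
  transitivity (\sum_i \sum_j (w i j - w j i) * a i).
    apply: eq_bigr => i _; rewrite !mxE -/(a i) -mulrBl -mulr_suml; congr (_ * _).
    rewrite intrB opprB addrC addrA subrK.
    rewrite (big_morph intr (@intrD R) (erefl _)) -sumrB big_mkcond/=.
    apply: eq_bigr => j _; case: ifPn => [/errE//|aij].
    by rewrite /w /v (adj_sym C j) (negPf aij) subrr.
  under eq_bigr do (under eq_bigr do rewrite mulrBl; rewrite sumrB).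
  rewrite sumrB [X in _ - X]exchange_big/= -sumrB; apply: eq_bigr => i _.
  by rewrite -sumrB; apply: eq_bigr => j _; rewrite /contribution mulrBr.
transitivity (\sum_i \sum_(m < n | (m < num_tokens C x i)%N)
    (mean_gain C x k r i - token_gain C k r i (c (i, m)))); last first.
  by rewrite pair_big_dep; apply: eq_big => [[i m]|[i m] _].
apply: eq_bigr => i _; rewrite sumrB.
have -> : \sum_(m < n | (m < num_tokens C x i)%N) mean_gain C x k r i =
    (num_tokens C x i)%:R * mean_gain C x k r i.
  rewrite -(big_num_tokens C x i +%R (fun=> mean_gain C x k r i)).
  by rewrite sumr_const card_ord mulr_natl.
rewrite num_tokens_mean_gain -/f.
transitivity (\sum_(j | v i j) (Defs.frac (f i j) * contribution C k i j r
     - Z i j * contribution C k i j r)).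
  rewrite [RHS]big_mkcond/=; apply: eq_bigr => j _; rewrite /w.
  by case: ifP; rewrite ?mul0r// mulrBl.
rewrite sumrB; congr (_ - _).
under eq_bigr do rewrite ZE mulr_suml.
rewrite exchange_big/=; apply: eq_bigr => m mN.
have := law0 (i, m) mN; rewrite /token_gain /=.
case: (c (i, m)) => [j|_]; last by rewrite big1// => j _; rewrite mul0r.
(* The token has a single, admissible destination, so exactly one summand survives. *)
move=> /token_law_Some_neq0[aij fij _].
rewrite (bigD1 j) /v ?aij//= eqxx mul1r big1 ?addr0// => j' /andP[_ jj'].
by rewrite (inj_eq Some_inj) eq_sym (negPf jj') mul0r.
Qed.

(** * Exponential moment of one round *)

Definition max_sqr_contribution (R : realType) (n : nat) (C : fos R n)
    (k : 'I_n) (r : nat) (i : 'I_n) : R :=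
  \big[Num.max/0]_(j | adj C i j) (contribution C k i j r ^+ 2).

(** The summand of index [r] in the squared refined local divergence, for a fixed node [k]. *)
Definition local_divergence (R : realType) (n : nat) (C : fos R n)
    (k : 'I_n) (r : nat) : R :=
  \sum_i max_sqr_contribution C k r i.

Lemma max_sqr_contribution_ge0 (R : realType) (n : nat) (C : fos R n) k r i :
  0 <= max_sqr_contribution C k r i.
Proof. exact: bigmax_ge_id. Qed.

Lemma local_divergence_ge0 (R : realType) (n : nat) (C : fos R n) k r :
  0 <= local_divergence C k r.
Proof. by apply: sumr_ge0 => i _; exact: max_sqr_contribution_ge0. Qed.

Lemma token_gain_le (R : realType) (n : nat) (C : fos R n) (x : 'rV[int]_n)
    k r i c :
  token_law C x i c != 0 ->
  `|token_gain C k r i c| <= Num.sqrt (max_sqr_contribution C k r i).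
Proof.
case: c => [j|_]; last by rewrite normr0 sqrtr_ge0.
move=> /token_law_Some_neq0[aij _ _]; rewrite -sqrtr_sqr ler_wsqrtr//.
exact: (le_bigmax_cond 0 (fun j => contribution C k i j r ^+ 2)).
Qed.

Lemma mean_gain_le (R : realType) (n : nat) (C : fos R n) (x : 'rV[int]_n)
    k r i :
  `|mean_gain C x k r i| <= Num.sqrt (max_sqr_contribution C k r i).
Proof.
rewrite -[leRHS]mul1r -(sum_token_law C x i) mulr_suml.
apply: (le_trans (ler_norm_sum _ _ _)); apply: ler_sum => c _.
rewrite normrM ger0_norm ?token_law_ge0//.
have [->|c0] := eqVneq (token_law C x i c) 0; first by rewrite !mul0r.
by rewrite ler_wpM2l ?token_law_ge0 ?(token_gain_le _ _ c0).
Qed.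

Lemma token_drift_le (R : realType) (n : nat) (C : fos R n) (x : 'rV[int]_n)
    k r i c :
  token_law C x i c != 0 ->
  `|mean_gain C x k r i - token_gain C k r i c|
  <= 2 * Num.sqrt (max_sqr_contribution C k r i).
Proof.
move=> c0; rewrite mulr_natl mulr2n (le_trans (ler_normB _ _))//.
by rewrite lerD ?mean_gain_le ?(token_gain_le _ _ c0).
Qed.

(** Subtracting the mean centres the term; the factor 2 in [token_drift_le] turns the constant 2 of
    [mgf_le] into 8. *)
Lemma token_mgf (R : realType) (n : nat) (C : fos R n) (x : 'rV[int]_n)
    k r i lam :
  \sum_c token_law C x i c *
    expR (lam * (mean_gain C x k r i - token_gain C k r i c))
  <= expR (8 * lam ^+ 2 * max_sqr_contribution C k r i).
Proof.
apply: (le_trans (mgf_le lam _ (sum_token_law C x i) _ (@token_drift_le _ _ C x k r i))).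
- exact: token_law_ge0.
- under eq_bigr do rewrite mulrBr.
  by rewrite sumrB -mulr_suml sum_token_law mul1r subrr.
- by rewrite exprMn sqr_sqrtr ?max_sqr_contribution_ge0// ler_expR; lra.
Qed.

(** Independence turns the expectation into a product over the slots; each node has at most
    [max_degree C] occupied slots, and each of them costs one [token_mgf]. *)
Lemma round_mgf (R : realType) (n : nat) (C : fos R n) (x : 'rV[int]_n)
    k r lam :
  \sum_c round_prob C x c * expR
    (lam * fos_load C (map_mx intr (rounded_step C x (round_choices c))) r 0 k)
  <= expR (lam * fos_load C (map_mx intr x) r.+1 0 k
           + 8 * lam ^+ 2 * ((max_degree C)%:R * local_divergence C k r)).
Proof.
pose h (p : 'I_n * 'I_n) c := if (p.2 < num_tokens C x p.1)%N
  then mean_gain C x k r p.1 - token_gain C k r p.1 c else 0.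
rewrite expRD.
have -> : \sum_c round_prob C x c * expR
    (lam * fos_load C (map_mx intr (rounded_step C x (round_choices c))) r 0 k) =
    expR (lam * fos_load C (map_mx intr x) r.+1 0 k) *
    \sum_(c : {ffun _}) \prod_p (choice_law C x p (c p) * expR (lam * h p (c p))).
  rewrite mulr_sumr; apply: eq_bigr => c _; rewrite big_split/= -/(round_prob C x c).
  (* [round_deviation] requires positive probability; the other outcomes have weight 0 on both
     sides. *)
  have [->|c0] := eqVneq (round_prob C x c) 0; first by rewrite !mul0r mulr0.
  rewrite (round_deviation _ _ c0) mulrDr expRD -expR_sum -mulr_sumr mulrCA.
  by congr (_ * (_ * expR (_ * _))); rewrite big_mkcond.
rewrite ler_wpM2l ?expR_ge0//.
rewrite -(bigA_distr_bigA (fun p c => choice_law C x p c * expR (lam * h p c))).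
pose b (p : 'I_n * 'I_n) := if (p.2 < num_tokens C x p.1)%N
  then 8 * lam ^+ 2 * max_sqr_contribution C k r p.1 else 0.
apply: (@le_trans _ _ (\prod_p expR (b p))).
  apply: ler_prod => p _; rewrite sumr_ge0 => [|c _]; last first.
    by rewrite mulr_ge0 ?choice_law_ge0 ?expR_ge0.
  rewrite /choice_law /h /b; case: (p.2 < _)%N; first exact: token_mgf.
  by rewrite big_option/= big1 ?mulr0 ?expR0 ?mulr1 ?addr0// => i _; rewrite mul0r.
rewrite -expR_sum ler_expR -(pair_bigA _ (fun i m => b (i, m)))/= mulr_sumr mulr_sumr.
apply: ler_sum => i _; rewrite /b/= -big_mkcond/=.
rewrite -(big_num_tokens C x i +%R (fun=> _)) sumr_const card_ord -[leLHS]mulr_natr -[leLHS]mulrA.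
rewrite ler_wpM2l ?(mulr_ge0 _ (sqr_ge0 _))//.
by rewrite mulrC ler_wpM2r ?max_sqr_contribution_ge0// ler_nat num_tokens_le_max_degree.
Qed.

(** All token terms are bounded by a vanishing maximum. This serves the degenerate case in which the
    optimal [lam] would be a division by zero. *)
Lemma round_fixed (R : realType) (n : nat) (C : fos R n) (x : 'rV[int]_n) k r c :
  local_divergence C k r = 0 -> round_prob C x c != 0 ->
  fos_load C (map_mx intr (rounded_step C x (round_choices c))) r 0 k
  = fos_load C (map_mx intr x) r.+1 0 k.
Proof.
move=> V0 c0; rewrite round_deviation// big1 ?addr0// => p pN.
have law0 : token_law C x p.1 (c p) != 0.
  apply: contra_neq c0 => e.
  by rewrite /round_prob (bigD1 p)//= /choice_law pN e mul0r.
have := token_drift_le k r law0.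
have -> : max_sqr_contribution C k r p.1 = 0.
  by apply: (psumr_eq0P _ V0) => // i _; exact: max_sqr_contribution_ge0.
by rewrite sqrtr0 mulr0 normr_le0 => /eqP.
Qed.

(** * Dependence on the history, and measurability *)

Lemma rounded_step_ext (R : realType) (n : nat) (C : fos R n) (x : 'rV[int]_n)
    (c c' : choices n) :
  (forall i m, (m < num_tokens C x i)%N -> c i m = c' i m) ->
  rounded_step C x c = rounded_step C x c'.
Proof.
move=> cc'; have tE i j : tokens_sent C x c i j = tokens_sent C x c' i j.
  by apply: eq_bigr => m _; rewrite cc'.
by apply/rowP => i; rewrite !mxE /rounded_flow; under eq_bigr do rewrite !tE.
Qed.

(** Histories are total functions, but only the destinations of actual excess tokens influence the
    loads. *)
Lemma rounded_load_ext (R : realType) (n : nat) (C : fos R n) (x0 : 'rV[int]_n)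
    (h h' : nat -> choices n) t :
  (forall s i m, (s < t)%N -> (m < num_tokens C (rounded_load C x0 h s) i)%N ->
     h s i m = h' s i m) ->
  rounded_load C x0 h t = rounded_load C x0 h' t.
Proof.
elim: t => [//|t IH] hh' /=; rewrite -IH => [|s i m st]; last first.
  by apply: hh'; rewrite ltnS ltnW.
by apply: rounded_step_ext => i m; exact: hh'.
Qed.

Lemma follows_load (R : realType) (n : nat) (C : fos R n) (x0 : 'rV[int]_n)
    (T : Type) (D : nat -> 'I_n -> nat -> T -> option 'I_n)
    (h : nat -> choices n) t w :
  follows C x0 D h t w ->
  rounded_load C x0 (fun s i m => D s i m w) t = rounded_load C x0 h t.
Proof.
by move=> hw; apply/esym; apply: rounded_load_ext => s i m st mN; rewrite hw.
Qed.

Lemma measurable_follows (R : realType) (n : nat) (C : fos R n)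
    (x0 : 'rV[int]_n) (disp : measure_display) (T : measurableType disp)
    (D : nat -> 'I_n -> nat -> T -> option 'I_n) h t :
  (forall s i m c, measurable [set w | D s i m w = c]) ->
  measurable (follows C x0 D h t).
Proof.
move=> mD.
have -> : follows C x0 D h t = \bigcap_(q in [set: 'I_t * 'I_n * 'I_n])
    (if (q.2 < num_tokens C (rounded_load C x0 h q.1.1) q.1.2)%N
     then [set w | D q.1.1 q.1.2 q.2 w = h q.1.1 q.1.2 q.2] else setT).
  apply/seteqP; split => [w hw [[s i] m] _ /=|w hw s i m st mN].
    by case: ifPn => // mN; apply: hw.
  have := hw (Ordinal st, i, Ordinal (leq_trans mN (num_tokens_le _ _ _))) I.
  by rewrite /= mN.
by apply: fin_bigcap_measurable => // q _; case: ifP => // _; exact: mD.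
Qed.

(** Loads and round choices form countable types, so the event is a countable union over the
    previous load and the last choices. [B] is general so that the induction hypothesis applies to
    the event of a given previous load. *)
Lemma measurable_rounded_load (R : realType) (n : nat) (C : fos R n)
    (x0 : 'rV[int]_n) (disp : measure_display) (T : measurableType disp)
    (D : nat -> 'I_n -> nat -> T -> option 'I_n)
    (B : set 'rV[int]_n) t :
  (forall s i m c, measurable [set w | D s i m w = c]) ->
  measurable [set w | B (rounded_load C x0 (fun s i m => D s i m w) t)].
Proof.
move=> mD; elim: t B => [|t IH] B /=.
  have [Bx|Bx] := pselect (B x0).
    by rewrite (_ : mkset _ = setT)//; apply/seteqP; split.
  by rewrite (_ : mkset _ = set0)//; apply/seteqP; split.
have -> : [set w | B (rounded_step C
      (rounded_load C x0 (fun s i m => D s i m w) t) (fun i m => D t i m w))] =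
    \bigcup_(q : 'rV[int]_n * {ffun 'I_n * 'I_n -> option 'I_n})
    ([set w | (B (rounded_step C q.1 (round_choices q.2)) /\
       rounded_load C x0 (fun s i m => D s i m w) t = q.1)] `&`
     \bigcap_(p in [set: 'I_n * 'I_n]) [set w | D t p.1 p.2 w = q.2 p]).
  apply/seteqP; split => [w Bw|w [[x c] _] [[/= Bxc xE] cE]].
    exists (rounded_load C x0 (fun s i m => D s i m w) t,
            [ffun p : 'I_n * 'I_n => D t p.1 p.2 w]) => //=.
    split; last by move=> p _ /=; rewrite ffunE.
    split=> //; rewrite (rounded_step_ext (c' := fun i m => D t i m w))// => i m mN.
    rewrite -[m]/(nat_of_ord (Ordinal (leq_trans mN (num_tokens_le _ _ _)))).
    by rewrite round_choicesE ffunE.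
  rewrite /= xE (rounded_step_ext (c' := round_choices c))// => i m mN.
  rewrite -[m]/(nat_of_ord (Ordinal (leq_trans mN (num_tokens_le _ _ _)))).
  by rewrite round_choicesE -(cE (i, _) I).
apply: countable_bigcupT_measurable => [|q]; first exact: countableP.
apply: measurableI.
  exact: (IH (fun x => B (rounded_step C q.1 (round_choices q.2)) /\ x = q.1)).
by apply: fin_bigcap_measurable => // p _; exact: mD.
Qed.

(** * Supermartingale bound along the rounds *)

Lemma measure_bigsetU_le (R : realType) (disp : measure_display)
    (T : measurableType disp) (P : {measure set T -> \bar R}) (I : finType)
    (Q : pred I) (F : I -> set T) :
  (forall i, Q i -> measurable (F i)) ->
  (P (\big[setU/set0]_(i | Q i) F i) <= \sum_(i | Q i) P (F i))%E.
Proof.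
move=> mF; suff : measurable (\big[setU/set0]_(i | Q i) F i) /\
  (P (\big[setU/set0]_(i | Q i) F i) <= \sum_(i | Q i) P (F i))%E by case.
elim/big_rec2: _ => [|i A s Qi [mA PA]]; first by rewrite measure0.
split; first by apply: measurableU => //; exact: mF.
by apply: (le_trans (measureU2 _ _ _)) => //; [exact: mF | exact: leeD2l].
Qed.

(** An empty slot that holds [None] contributes the factor 1, so the product over the grid reduces
    to the actual tokens. *)
Lemma round_prob_tokens (R : realType) (n : nat) (C : fos R n) (x : 'rV[int]_n)
    (c : {ffun 'I_n * 'I_n -> option 'I_n}) :
  (forall p : 'I_n * 'I_n, ~~ (p.2 < num_tokens C x p.1)%N -> c p = None) ->
  \prod_(i < n) \prod_(m < num_tokens C x i)
    token_law C x i (round_choices c i m) = round_prob C x c.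
Proof.
move=> cN; transitivity (\prod_i \prod_m choice_law C x (i, m) (c (i, m))); last first.
  by rewrite pair_bigA; apply: eq_bigr => [[i m] _].
apply: eq_bigr => i _.
rewrite (big_num_tokens C x i *%R (fun m => token_law C x i (round_choices c i m))).
rewrite big_mkcond/=; apply: eq_bigr => m _; rewrite round_choicesE /choice_law /=.
by case: ifPn => // mN; rewrite cN.
Qed.

(* A potential that does not increase in expectation along the rounds and is at
   least 1 on B bounds the probability of ending up in B. *)
Lemma prob_load_le (R : realType) (n : nat) (C : fos R n) (x0 : 'rV[int]_n)
    (disp : measure_display) (T : measurableType disp) (P : probability T R)
    (D : nat -> 'I_n -> nat -> T -> option 'I_n)
    (Psi : nat -> 'rV[int]_n -> R) (B : set 'rV[int]_n) :
  randomized_rounding C x0 P D ->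
  (forall r x, 0 <= Psi r x) ->
  (forall x, B x -> 1 <= Psi 0%N x) ->
  (forall r x, \sum_c round_prob C x c *
     Psi r (rounded_step C x (round_choices c)) <= Psi r.+1 x) ->
  forall t,
  (P [set w | B (rounded_load C x0 (fun s i m => D s i m w) t)]
   <= (Psi t x0)%:E)%E.
Proof.
move=> [mD PD] Psi0 PsiB PsiS t.
pose A t := [set w | B (rounded_load C x0 (fun s i m => D s i m w) t)].
have mA u : measurable (A u) by exact: measurable_rounded_load.
have mF h u : measurable (follows C x0 D h u) by exact: measurable_follows.
(* Conditional form: the first [s] rounds follow [h] and [r] rounds remain; [s = 0] gives the
   claim. *)
suff H r s h : (P (follows C x0 D h s `&` A (s + r)%N) <=
    P (follows C x0 D h s) * (Psi r (rounded_load C x0 h s))%:E)%E.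
  have := H t 0%N (fun _ _ _ => None).
  have -> : follows C x0 D (fun _ _ _ => None) 0 = setT by apply/seteqP; split.
  by rewrite setTI probability_setT mul1e.
elim: r s h => [|r IH] s h.
  rewrite addn0; have [Bx|Bx] := pselect (B (rounded_load C x0 h s)).
    apply: (@le_trans _ _ (P (follows C x0 D h s))).
      by apply: le_measure; rewrite ?inE//; exact: measurableI.
    by rewrite lee_pemulr// lee_fin PsiB.
  rewrite (_ : _ `&` _ = set0) ?measure0 ?mule_ge0 ?lee_fin//.
  by apply/seteqP; split => // w [hw]; rewrite /A/= (follows_load hw).
set x := rounded_load C x0 h s.
(* If [c] is not [None] in some empty slot, [round_prob] is 0, although following [c] may have
   positive probability; such [c] are left out. *)
pose can (c : {ffun 'I_n * 'I_n -> option 'I_n}) :=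
  [forall p : 'I_n * 'I_n, (p.2 < num_tokens C x p.1)%N || (c p == None)].
pose ext c u := if u == s then round_choices c else h u.
have extE c : rounded_load C x0 (ext c) s = x.
  by apply: rounded_load_ext => u i m us _; rewrite /ext ltn_eqF.
have follows_ext c : follows C x0 D (ext c) s = follows C x0 D h s.
  have loadE u : (u < s)%N -> rounded_load C x0 (ext c) u = rounded_load C x0 h u.
    move=> us; apply: rounded_load_ext => v i m vu _.
    by rewrite /ext ltn_eqF// (ltn_trans vu).
  apply/seteqP; split => w hw u i m us; have := hw u i m us;
    by rewrite loadE// /ext ltn_eqF.
(* The event is split by the choices made in round [s]. *)
have cover : follows C x0 D h s `&` A (s + r.+1)%N `<=`
    \big[setU/set0]_(c | can c) (follows C x0 D (ext c) s.+1 `&` A (s.+1 + r)%N).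
  move=> w [hw Aw].
  pose c := [ffun p : 'I_n * 'I_n =>
    if (p.2 < num_tokens C x p.1)%N then D s p.1 p.2 w else None].
  rewrite -bigcup_seq_cond; exists c => /=.
    rewrite mem_index_enum; apply/forallP => p; rewrite ffunE.
    by case: ifP => //=.
  split; last by rewrite addSnnS.
  move=> u i m; rewrite ltnS leq_eqVlt => /predU1P[->|us].
    rewrite extE /ext eqxx => mN.
    rewrite -[m]/(nat_of_ord (Ordinal (leq_trans mN (num_tokens_le _ _ _)))).
    by rewrite round_choicesE ffunE /= mN.
  by move: hw; rewrite -(follows_ext c); apply.
have Pext c : can c -> P (follows C x0 D (ext c) s.+1) =
    (P (follows C x0 D h s) * (round_prob C x c)%:E)%E.
  move=> /forallP cN; rewrite PD extE follows_ext {1}/ext eqxx round_prob_tokens//.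
  by move=> p /negPf pN; have := cN p; rewrite pN => /eqP.
have loadS c : rounded_load C x0 (ext c) s.+1 = rounded_step C x (round_choices c).
  by rewrite /= extE /ext eqxx.
have mFA c : can c -> measurable (follows C x0 D (ext c) s.+1 `&` A (s.+1 + r)%N).
  by move=> _; exact: measurableI.
have [p p0 pE] : exists2 p : R, 0 <= p & P (follows C x0 D h s) = p%:E.
  have Pfin := fin_num_measure P _ (mF h s).
  by exists (fine (P (follows C x0 D h s))); rewrite ?fine_ge0 ?fineK.
apply: (@le_trans _ _ (\sum_(c | can c)
    P (follows C x0 D (ext c) s.+1 `&` A (s.+1 + r)%N))%E).
  apply: le_trans (measure_bigsetU_le P mFA).
  by apply: le_measure; rewrite ?inE//; [exact: measurableI | exact: bigsetU_measurable].
apply: (@le_trans _ _ (\sum_(c | can c)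
    (p * (round_prob C x c * Psi r (rounded_step C x (round_choices c))))%:E)%E).
  apply: lee_sum => c cc; apply: (le_trans (IH _ _)).
  by rewrite Pext// pE loadS -!EFinM mulrA.
rewrite sumEFin pE -EFinM lee_fin -mulr_sumr ler_wpM2l//.
(* Dropping the restriction to [can] only adds nonnegative terms. *)
apply: le_trans (PsiS r x); rewrite big_mkcond/=; apply: ler_sum => c _.
by case: ifP => // _; rewrite mulr_ge0 ?round_prob_ge0.
Qed.

(** * Tail bounds for the deviation at one node *)

Lemma prob_deviation_le (R : realType) (n : nat) (C : fos R n) (x0 : 'rV[int]_n)
    (disp : measure_display) (T : measurableType disp) (P : probability T R)
    (D : nat -> 'I_n -> nat -> T -> option 'I_n) (t : nat) (k : 'I_n) (lam v : R) :
  randomized_rounding C x0 P D ->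
  (P [set w | (v <= lam *
       ((rounded_load C x0 (fun s i m => D s i m w) t 0%R k)%:~R
        - fos_load C (map_mx intr x0) t 0%R k))%R]
   <= (expR (8 * lam ^+ 2 *
         ((max_degree C)%:R * \sum_(r < t) local_divergence C k r) - v))%:E)%E.
Proof.
move=> rr; set z := fos_load _ _ _ _ _.
(* [r] counts the rounds left, so the sum is the divergence still to be paid, and the last round
   pays index 0. *)
pose Psi r x := expR (lam * (fos_load C (map_mx intr x) r 0 k - z) +
  8 * lam ^+ 2 * ((max_degree C)%:R * \sum_(s < r) local_divergence C k s) - v).
have -> : 8 * lam ^+ 2 *
    ((max_degree C)%:R * \sum_(r < t) local_divergence C k r) - v =
    lam * (fos_load C (map_mx intr x0) t 0 k - z) + 8 * lam ^+ 2 *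
    ((max_degree C)%:R * \sum_(r < t) local_divergence C k r) - v.
  by rewrite subrr mulr0 add0r.
apply: (prob_load_le (Psi := Psi)
  (B := [set x : 'rV[int]_n | v <= lam * ((x 0 k)%:~R - z)]) rr _ _ _ t).
- by move=> r x; exact: expR_ge0.
- move=> x /= vx; rewrite /Psi big_ord0 !mulr0 addr0 /fos_load/= mxE.
  by rewrite -[leLHS]expR0 ler_expR subr_ge0.
- move=> r x; rewrite /Psi.
  set V := \sum_(s < r) _; set d := (max_degree C)%:R.
  have split_exp (y : R) : expR (lam * (y - z) + 8 * lam ^+ 2 * (d * V) - v) =
      expR (lam * y) * expR (8 * lam ^+ 2 * (d * V) - v - lam * z).
    by rewrite -expRD; congr expR; ring.
  under eq_bigr do rewrite split_exp mulrA.
  rewrite -mulr_suml.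
  apply: (le_trans (ler_wpM2r (expR_ge0 _) (round_mgf C x k r lam))).
  by rewrite -expRD ler_expR big_ord_recr/= -/V -/d; lra.
Qed.

(** The potential indicates that the continuous forecast for node [k] differs from [z]; by
    [round_fixed] this forecast almost surely never changes. *)
Lemma prob_deviation0 (R : realType) (n : nat) (C : fos R n) (x0 : 'rV[int]_n)
    (disp : measure_display) (T : measurableType disp) (P : probability T R)
    (D : nat -> 'I_n -> nat -> T -> option 'I_n) (t : nat) (k : 'I_n) :
  randomized_rounding C x0 P D ->
  (forall r, local_divergence C k r = 0) ->
  P [set w | (rounded_load C x0 (fun s i m => D s i m w) t 0 k)%:~R
             != fos_load C (map_mx intr x0) t 0 k] = 0%E.
Proof.
move=> rr V0; set z := fos_load _ _ _ _ _.
apply/eqP; rewrite eq_le measure_ge0 andbT.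
pose Psi r x : R := (fos_load C (map_mx intr x) r 0 k != z)%:R.
have -> : 0%E = (Psi t x0)%:E by rewrite /Psi eqxx.
apply: (prob_load_le (Psi := Psi)
  (B := [set x : 'rV[int]_n | (x 0 k)%:~R != z]) rr _ _ _ t).
- by move=> r x; exact: ler0n.
- by move=> x /= xz; rewrite /Psi /fos_load/= mxE xz.
- move=> r x; rewrite (eq_bigr (fun c => round_prob C x c * Psi r.+1 x)).
    by rewrite -mulr_suml sum_round_prob mul1r.
  move=> c _; have [->|c0] := eqVneq (round_prob C x c) 0; first by rewrite !mul0r.
  by rewrite /Psi round_fixed.
Qed.

(** * Comparison with the refined local divergence, and conclusion *)

(** Without edges all inner maxima range over the empty set. Positivity allows the division by the
    degree in [lam]. *)
Lemma max_degree_gt0 (R : realType) (n : nat) (C : fos R n) k r :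
  local_divergence C k r != 0 -> (0 < max_degree C)%N.
Proof.
rewrite lt0n; apply: contra_neq => d0; apply: big1 => i _; apply: big_pred0 => j.
have : (#|[set j | adj C i j]%SET| <= max_degree C)%N.
  exact: (leq_bigmax (F := fun i => #|[set j | adj C i j]%SET|)).
by rewrite d0 leqn0 cards_eq0 => /eqP/setP/(_ j); rewrite !inE.
Qed.

Lemma le_refined_local_divergence (R : realType) (n : nat) (C : fos R n) k :
  (sqrte (\sum_(0 <= s <oo) (local_divergence C k s)%:E)
   <= refined_local_divergence C)%E.
Proof.
exact: (le_bigmax -oo%E (fun k : 'I_n =>
  sqrte (\sum_(0 <= s <oo) (local_divergence C k s)%:E))%E).
Qed.

Theorem theorem3 (R : realType) :
  exists a K : R, 0 < a /\ 0 < K /\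
  forall (n : nat) (C : fos R n) (x0 : 'rV[int]_n)
    (disp : measure_display) (T : measurableType disp) (P : probability T R)
    (D : nat -> 'I_n -> nat -> T -> option 'I_n),
  (2 <= n)%N ->
  randomized_rounding C x0 P D ->
  forall (t : nat) (k : 'I_n),
  ((1 - n%:R `^ (- a))%R%:E <=
   P [set w |
      (`| (rounded_load C x0 (fun s i m => D s i m w) t 0 k)%:~R
          - fos_load C (map_mx intr x0) t 0 k |%R%:E <=
       K%:E * refined_local_divergence C
         * (Num.sqrt ((max_degree C)%:R * ln (n%:R : R)))%R%:E)%E])%E.
Proof.
(* The constant 10 makes each of the two tails at most [n%:R ^- 2]; their sum is at most [n%:R^-1]
   because [2 <= n], whence [a = 1]. *)
exists 1, 10; split=> //; split=> // n C x0 disp T P D n2 rr t k.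
set z := fos_load _ _ _ _ _; set d : R := (max_degree C)%:R.
set L := ln (n%:R : R); set rhs := (_ * _)%E.
set good := mkset _.
have mX B : measurable [set w | B (rounded_load C x0 (fun s i m => D s i m w) t)].
  by apply: measurable_rounded_load; case: rr.
have mgood : measurable good.
  exact: (mX (fun x => `| (x 0 k)%:~R - z |%R%:E <= rhs)%E).
suff bad_le : (P (~` good) <= (n%:R^-1)%:E)%E.
  rewrite powRN powRr1// -[good]setCK probability_setC; last exact: measurableC.
  by rewrite EFinB; exact: leeB.
have n0 : (0 : R) < n%:R by rewrite ltr0n (leq_trans _ n2).
have L0 : 0 < L by rewrite ln_gt0// ltr1n.
pose S := (\sum_(0 <= s <oo) (local_divergence C k s)%:E)%E.
have V0 s : (0 <= (local_divergence C k s)%:E)%E.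
  by rewrite lee_fin local_divergence_ge0.
have rhs_ge : (10%:E * sqrte S * (Num.sqrt (d * L))%:E <= rhs)%E.
  rewrite lee_wpmul2r ?lee_fin ?sqrtr_ge0// lee_wpmul2l ?lee_fin//.
  exact: le_refined_local_divergence.
have [VE|] := pselect (forall r, local_divergence C k r = 0).
  apply: (@le_trans _ _ 0%E); last by rewrite lee_fin invr_ge0 ltW.
  rewrite -(prob_deviation0 t rr VE); apply: le_measure.
  - by rewrite inE; exact: measurableC.
  - by rewrite inE; exact: (mX (fun x => (x 0 k)%:~R != z)).
  move=> w /=; apply: contra_notN => /eqP e; rewrite /good/= e subrr normr0.
  by apply: le_trans rhs_ge; rewrite !mule_ge0 ?lee_fin ?sqrtr_ge0 ?sqrte_ge0.
move=> /existsNP[r /eqP Vr].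
have d0 : 0 < d by rewrite ltr0n (max_degree_gt0 Vr).
have SV u : ((\sum_(s < u) local_divergence C k s)%:E <= S)%E.
  rewrite -sumEFin -(big_mkord xpredT (fun s => (local_divergence C k s)%:E)).
  exact: nneseries_lim_ge.
have S0 : (0 < S)%E.
  apply: lt_le_trans (SV r.+1); rewrite lte_fin big_ord_recr/=.
  rewrite ltr_wpDl ?lt0r ?Vr ?local_divergence_ge0//.
  by apply: sumr_ge0 => s _; exact: local_divergence_ge0.
(* If the series diverges, the bound is infinite, since [d] and [L] are positive, and the bad event
   is empty. *)
clearbody S; case: S => [s| |] // in rhs_ge SV S0; last first.
  have -> : ~` good = set0.
    apply/seteqP; split => // w /=; apply; apply: le_trans rhs_ge.
    by rewrite /= gt0_muley ?gt0_mulye ?leey// lte_fin ?sqrtr_gt0 ?mulr_gt0.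
  by rewrite measure0 lee_fin invr_ge0 ltW.
rewrite lte_fin in S0; rewrite /= -!EFinM in rhs_ge.
(* The exponent 8 lam^2 s d - lam * 10 sqrt (s d L) then equals - 2 L. *)
pose lam := Num.sqrt (L / (s * d)).
(* The sign [e], equal to 1 or -1, selects the upper or the lower tail. *)
pose tail e := [set w | 10 * L <=
  e * lam * ((rounded_load C x0 (fun s i m => D s i m w) t 0 k)%:~R - z)].
have mtail e : measurable (tail e).
  exact: (mX (fun x => 10 * L <= e * lam * ((x 0 k)%:~R - z))).
have tail_le e : e ^+ 2 = 1 -> (P (tail e) <= (n%:R ^- 2)%:E)%E.
  move=> e2; apply: (le_trans (prob_deviation_le t k (e * lam) (10 * L) rr)).
  have -> : n%:R ^- 2 = expR (- (L + L)).
    by rewrite expRN expRD lnK ?posrE// -expr2.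
  rewrite lee_fin ler_expR exprMn e2 mul1r sqr_sqrtr; last first.
    by rewrite divr_ge0 ?mulr_ge0 ?ltW.
  have := SV t; rewrite lee_fin -/d; set V := \sum_(_ < _) _ => Vs.
  have -> : 8 * (L / (s * d)) * (d * V) = 8 * L * (V / s).
    by field; rewrite !gt_eqF.
  (* A partial sum [V] smaller than [s] only lowers the exponent. *)
  have : L * (V / s) <= L by rewrite ler_piMr ?(ltW L0)// ler_pdivrMr// mul1r.
  by lra.
apply: (@le_trans _ _ (P (tail 1 `|` tail (-1)))).
  apply: le_measure; rewrite ?inE; [exact: measurableC|exact: measurableU|].
  move=> w; rewrite /good /tail/=; set X := _%:~R - z => /negP; rewrite -ltNge => /(le_lt_trans rhs_ge).
  rewrite lte_fin => /ltW dev.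
  (* The factors [s * d] cancel: [lam] times the threshold is [10 * L]. *)
  have lam_dev : 10 * L <= lam * `|X|.
    apply: le_trans (ler_wpM2l (sqrtr_ge0 _) dev).
    have LE : L / (s * d) * (s * (d * L)) = L ^+ 2 by field; rewrite !gt_eqF.
    have Lsd : 0 <= L / (s * d) by rewrite divr_ge0 ?mulr_ge0 ?ltW.
    rewrite -mulrA [leRHS]mulrCA -(sqrtrM _ (ltW S0)) -(sqrtrM _ Lsd) LE.
    by rewrite sqrtr_sqr ger0_norm// ltW.
  have [X0|X0] := leP 0 X; [left|right]; rewrite ?mulN1r ?mul1r.
    by rewrite -{1}(ger0_norm X0).
  by rewrite mulNr -mulrN -(ltr0_norm X0).
apply: (le_trans (measureU2 _ _ _)) => //.
apply: (le_trans (leeD (tail_le _ _) (tail_le _ _))); rewrite ?sqrrN ?expr1n//.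
rewrite -EFinD lee_fin expr2 invfM -mulrDl ler_piMl ?invr_ge0 ?(ltW n0)//.
have -> : n%:R^-1 + n%:R^-1 = 2 / n%:R :> R by rewrite mulr_natl mulr2n.
by rewrite ler_pdivrMr// mul1r ler_nat.
Qed.
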